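(* Let the control-model assumptions in the context hold, and let $J^{\rm AC}$ and $(\rho^\star,u^\star)$ be the optimal value and an optimizer of the program $(\mathrm{AC})$. Consider the semi-infinite program $(\mathrm{AC}_n)$ with $\theta_{\mathcal P}>\|\psi\|_{\rm L}$, and let $\mathbb U_n:=\{\sum_{i=1}^n\alpha_iu_i:\ \|\alpha\|_{\mathfrak R}\le\theta_{\mathcal P}\}$. Then $$0\le J^{\rm AC}-J_n^{\rm AC}\le\big(1+\max\{L_Q,1\}\big)\,\big\|u^\star-\Pi_{\mathbb U_n}(u^\star)\big\|_{\rm L},$$ where $\Pi_{\mathbb U_n}(u^\star)\in\arg\min_{u\in\mathbb U_n}\|u-u^\star\|_{\rm L}$.
   Context: Control model: $S$ and $A$ are unit hypercubes and $K=S\times A=[0,1]^{\dim(S\times A)}$. $Q$ is a stochastic kernel on $S$ given $K$, $Qu(s,a):=\int_Su(s')Q(\mathrm ds'|s,a)$, and there is $L_Q>0$ with $|Qu(k)-Qu(k')|\le L_Q\|u\|_\infty\|k-k'\|_{\ell_\infty}$ for all $k,k'\in K$ and all continuous $u:S\to\mathbb R$. The cost $\psi:K\to\mathbb R$ is non-negative and Lipschitz with respect to $\ell_\infty$. For a function $u$ on $S$ (or $K$), $\|u\|_\infty=\sup|u|$ and $\|u\|_{\rm L}:=\max\{\|u\|_\infty,\sup_{s\ne s'}|u(s)-u(s')|/\|s-s'\|_{\ell_\infty}\}$; $\mathscr L(S)$ is the space of Lipschitz functions on $S$. Average-cost LP: $$(\mathrm{AC}):\quad-J^{\rm AC}=\inf_{\rho\in\mathbb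 R,\,u\in\mathscr L(S)}\{-\rho:\ \rho+u(s)-Qu(s,a)\le\psi(s,a)\ \forall(s,a)\in K\}.$$ $u_1,\dots,u_n\in\mathscr L(S)$ are linearly independent with $\|u_i\|_{\rm L}=1$; $\|\cdot\|_{\mathfrak R}$ is a norm on $\mathbb R^n$. Semi-infinite approximation: $$(\mathrm{AC}_n):\quad-J_n^{\rm AC}=\inf_{(\rho,\alpha)\in\mathbb R\times\mathbb R^n}\Big\{-\rho:\ \rho+\sum_{i=1}^n\alpha_i\big(u_i(s)-Qu_i(s,a)\big)\le\psi(s,a)\ \forall(s,a)\in K,\ \|\alpha\|_{\mathfrak R}\le\theta_{\mathcal P}\Big\}.$$ *)

(* Defs.v *)
From HB Require Import structures.
From mathcomp Require Import all_boot all_order all_algebra.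
From mathcomp Require Import all_classical all_reals all_analysis.

Set Implicit Arguments.
Unset Strict Implicit.
Unset Printing Implicit Defensive.

Import Order.TTheory GRing.Theory Num.Theory.
Import numFieldNormedType.Exports.

Local Open Scope classical_set_scope.
Local Open Scope ring_scope.

Definition unit_cube (R : realType) (p : nat) : set 'rV[R]_p :=
  [set x | forall i, 0 <= x ord0 i <= 1].

Arguments unit_cube : clear implicits.

(* [0,1]^p as a type, with the topology induced by 'rV[R]_p *)
Definition cube (R : realType) (p : nat) : Type := set_type (unit_cube R p).

Lemma unit_cube0 (R : realType) (p : nat) :
  (0 : 'rV[R]_p) \in unit_cube R p.
Proof. by rewrite inE => i; rewrite mxE lexx ler01. Qed.

HB.instance Definition _ (R : realType) (p : nat) :=
  PseudoMetric.copy (cube R p) (set_type (unit_cube R p)).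
HB.instance Definition _ (R : realType) (p : nat) :=
  isPointed.Build (cube R p) (exist _ 0 (unit_cube0 R p)).

Notation borel T := (g_sigma_algebraType (@open T)).

(* the norm of 'rV[R]_p is the maximum of the absolute values of the entries *)
Definition cube_dist (R : realType) (p : nat) (x y : cube R p) : R :=
  `|set_val x - set_val y|.

(* K = S x A = [0,1]^(p + q) *)
Notation SA R p q := (cube R p * cube R q)%type.

Definition SA_dist (R : realType) (p q : nat) (k k' : SA R p q) : R :=
  Num.max (cube_dist k.1 k'.1) (cube_dist k.2 k'.2).

Section function_norms.
Context {R : realType} {T : Type} (d : T -> T -> R).
Local Open Scope ereal_scope.

Definition is_lipschitz (u : T -> R) : Prop :=
  exists L : R, forall x y, (`|u x - u y| <= L * d x y)%R.

Definition sup_norm (u : T -> R) : \bar R :=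
  ereal_sup [set `|u x|%:E | x in [set: T]].

Definition lip_norm (u : T -> R) : \bar R :=
  maxe (sup_norm u)
       (ereal_sup [set (`|u z.1 - u z.2| / d z.1 z.2)%:E
                  | z in [set z : T * T | z.1 <> z.2]]).

End function_norms.

Definition argmin (R : realType) (T : Type) (f : T -> \bar R) (F : set T) :
    set T :=
  [set x | F x /\ forall y, F y -> (f x <= f y)%E].

Definition is_norm (R : realType) (n : nat) (N : 'rV[R]_n -> R) : Prop :=
  [/\ forall x y, N (x + y) <= N x + N y,
      forall (c : R) x, N (c *: x) = `|c| * N x &
      forall x, N x = 0 -> x = 0].

Definition lin_indep (R : realType) (T : Type) (n : nat)
    (u : 'I_n -> T -> R) : Prop :=
  forall c : 'I_n -> R,
    (forall x, \sum_(i < n) c i * u i x = 0) -> forall i, c i = 0.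

Section average_cost.
Context {R : realType} {p q : nat}.
Variable Q : R.-pker (borel (SA R p q)) ~> (borel (cube R p)).

Definition Qop (u : cube R p -> R) (k : SA R p q) : R :=
  Rintegral (Q k) [set: borel (cube R p)] u.

Definition kernel_lipschitz (LQ : R) : Prop :=
  forall u : cube R p -> R, continuous u -> forall k k' : SA R p q,
    (`|Qop u k - Qop u k'|%:E <= LQ%:E * sup_norm u * (SA_dist k k')%:E)%E.

Variable psi : SA R p q -> R.

Definition AC_feasible : set (R * (cube R p -> R)) :=
  [set z | is_lipschitz (@cube_dist R p) z.2 /\
     forall (s : cube R p) (a : cube R q),
       z.1 + z.2 s - Qop z.2 (s, a) <= psi (s, a)].

Definition J_AC : \bar R :=
  (- ereal_inf [set (- z.1)%:E | z in AC_feasible])%E.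

Definition AC_optimizers : set (R * (cube R p -> R)) :=
  argmin (fun z => (- z.1)%:E) AC_feasible.

Context {n : nat}.
Variables (u : 'I_n -> cube R p -> R) (N : 'rV[R]_n -> R) (thetaP : R).

Definition ACn_feasible : set (R * 'rV[R]_n) :=
  [set z : R * 'rV[R]_n | (forall (s : cube R p) (a : cube R q),
       z.1 + \sum_(i < n) z.2 ord0 i * (u i s - Qop (u i) (s, a))
       <= psi (s, a)) /\
     N z.2 <= thetaP].

Definition J_ACn : \bar R :=
  (- ereal_inf [set (- z.1)%:E | z in ACn_feasible])%E.

Definition Un : set (cube R p -> R) :=
  [set (fun s => \sum_(i < n) alpha ord0 i * u i s)
  | alpha in [set alpha : 'rV[R]_n | N alpha <= thetaP]].

End average_cost.

(* Main.v *)
Require Import Defs.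
From mathcomp Require Import all_boot all_order all_algebra.
From mathcomp Require Import all_classical all_reals all_analysis.
From mathcomp Require Import measurable_realfun lra.
Import Order.TTheory GRing.Theory Num.Theory.
Import numFieldNormedType.Exports.
Local Open Scope classical_set_scope.
Local Open Scope ring_scope.

(** Lipschitz functions on the cube are bounded and Borel, hence integrable, so
    [Qop] is linear on them and contracts the sup norm. A point of (AC_n) is
    therefore a point of (AC) with the same objective, which gives the lower
    bound. Conversely, replacing [ustar] by [Piu] changes [u - Qop u] by at most
    twice the sup norm of [ustar - Piu], so lowering [rhostar] by that amount
    gives a feasible point of (AC_n); finally [2 <= 1 + max LQ 1]. *)

Lemma is_lipschitz_lincomb (R : realType) (T : Type) (d : T -> T -> R) (n : nat)
    (c : 'I_n -> R) (u : 'I_n -> T -> R) :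
  (forall i, is_lipschitz d (u i)) ->
  is_lipschitz d (fun x => \sum_(i < n) c i * u i x).
Proof.
move=> /choice[L uL]; exists (\sum_(i < n) `|c i| * L i) => x y.
rewrite -sumrB (le_trans (ler_norm_sum _ _ _))// mulr_suml.
apply: ler_sum => i _; rewrite -mulrBr normrM -mulrA.
exact: ler_wpM2l.
Qed.

Lemma is_lipschitzB (R : realType) (T : Type) (d : T -> T -> R) (u v : T -> R) :
  is_lipschitz d u -> is_lipschitz d v -> is_lipschitz d (fun x => u x - v x).
Proof.
move=> [L uL] [M vM]; exists (L + M) => x y.
rewrite mulrDl (_ : _ - _ - _ = (u x - u y) - (v x - v y)); last by lra.
exact: le_trans (ler_normB _ _) (lerD (uL x y) (vM x y)).
Qed.

Lemma sup_norm_ub (R : realType) (T : Type) (u : T -> R) (x : T) :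
  (`|u x|%:E <= sup_norm u)%E.
Proof. by apply: ereal_sup_ubound; exists x. Qed.

Lemma le_sup_lip_norm (R : realType) (T : Type) (d : T -> T -> R) (u : T -> R) :
  (sup_norm u <= lip_norm d u)%E.
Proof. by rewrite /lip_norm le_max lexx. Qed.

Section lipschitz_cube.
Context {R : realType} {p : nat}.
Implicit Types (x y : cube R p) (u : cube R p -> R).

Lemma cube_dist_le1 x y : cube_dist x y <= 1.
Proof.
rewrite /cube_dist /Num.Def.normr /= mx_normrE; apply: bigmax_le => // -[i j] _ /=.
have val01 (z : cube R p) : 0 <= set_val z i j <= 1.
  by rewrite [i](ord1 i); exact: (set_valP z).
move: (val01 x) (val01 y) => /andP[x0 x1] /andP[y0 y1]; rewrite !mxE.
rewrite ler_norml; apply/andP; split; lra.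
Qed.

Lemma lipschitz_continuous u : is_lipschitz (@cube_dist R p) u -> continuous u.
Proof.
move=> [L uL] x; have xF : Filter (nbhs x) by exact: (@nbhs_filter (cube R p)).
apply/(@cvgrPdist_le _ _ _ _ xF) => e e0.
(* [L] may be zero or negative, so [|L| + 1] serves as a positive divisor of [e]. *)
have L1 : 0 < `|L| + 1 by rewrite ltr_wpDl.
(* The cube carries the initial topology of [set_val], so [cube_dist] to [x] becomes small near
   [x]. *)
have /cvgrPdist_lt : (set_val : cube R p -> 'rV[R]_p) y @[y --> x] --> set_val x.
  exact: initial_continuous.
move=> /(_ (e / (`|L| + 1)) (divr_gt0 e0 L1)).
apply: filterS => y; rewrite ltr_pdivlMr// => xy.
apply: (le_trans (uL x y)); apply: le_trans (ltW xy); rewrite mulrC.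
apply: ler_wpM2l; first exact: normr_ge0.
by rewrite (le_trans (ler_norm _))// lerDl.
Qed.

(** Open intervals generate the Borel sets of the line, and continuity makes their preimages open,
    hence Borel in the cube. *)
Lemma lipschitz_measurable u : is_lipschitz (@cube_dist R p) u ->
  measurable_fun [set: borel (cube R p)] (u : borel (cube R p) -> R).
Proof.
move=> /lipschitz_continuous /continuousP cu.
apply: (measurability _ (RGenOpens.measurableE R)).
move=> _ [_ [a [b ->] <-]]; rewrite setTI; apply: sub_sigma_algebra.
exact/cu/interval_open.
Qed.

(** The cube has diameter at most 1, so [u] stays within [|L|] of its value at [point]. *)
Lemma lipschitz_bounded u : is_lipschitz (@cube_dist R p) u ->
  exists M, forall x, `|u x| <= M.
Proof.
move=> [L uL]; exists (`|u point| + `|L|) => x.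
rewrite -[u x](subrK (u point)) (le_trans (ler_normD _ _))// addrC lerD2l.
apply: (le_trans (uL _ _)); apply: (@le_trans _ _ (`|L| * cube_dist x point)).
  by apply: ler_wpM2r; [exact: normr_ge0|exact: ler_norm].
by rewrite ler_piMr// cube_dist_le1.
Qed.

Lemma lipschitz_integrable (mu : {measure set (borel (cube R p)) -> \bar R}) u :
  (mu [set: borel (cube R p)] < +oo)%E -> is_lipschitz (@cube_dist R p) u ->
  mu.-integrable [set: borel (cube R p)] (EFin \o u).
Proof.
move=> muoo uL; apply: measurable_bounded_integrable => //.
- exact: lipschitz_measurable.
- have [M uM] := lipschitz_bounded u uL.
  exists M; split; first by rewrite num_real.
  by move=> N MN x _ /=; exact: le_trans (uM x) (ltW MN).
Qed.

End lipschitz_cube.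

Section Qop_linear.
Context {R : realType} {p q : nat}.
Variable Q : R.-pker (borel (SA R p q)) ~> (borel (cube R p)).
Implicit Types (k : SA R p q) (u v : cube R p -> R).

Lemma Qop_integrable u k : is_lipschitz (@cube_dist R p) u ->
  (Q k).-integrable [set: borel (cube R p)] (EFin \o u).
Proof.
apply: (lipschitz_integrable (Q k)).
by have /= -> := @prob_kernel _ _ _ _ _ Q k; exact: ltry.
Qed.

Lemma QopB u v k : is_lipschitz (@cube_dist R p) u ->
  is_lipschitz (@cube_dist R p) v ->
  Qop Q (fun s => u s - v s) k = Qop Q u k - Qop Q v k.
Proof. by move=> uL vL; apply: RintegralB => //; exact: Qop_integrable. Qed.

Lemma Qop_lincomb (n : nat) (c : 'I_n -> R) (u : 'I_n -> cube R p -> R) k :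
  (forall i, is_lipschitz (@cube_dist R p) (u i)) ->
  Qop Q (fun s => \sum_(i < n) c i * u i s) k = \sum_(i < n) c i * Qop Q (u i) k.
Proof.
elim: n c u => [|n IH] c u uL.
  rewrite big_ord0 /Qop; under eq_Rintegral do rewrite big_ord0.
  by rewrite Rintegral_cst// mul0r.
rewrite big_ord_recl -IH; last by move=> i; exact: uL.
rewrite /Qop -RintegralZl//; last exact: Qop_integrable.
under [LHS]eq_Rintegral do rewrite big_ord_recl.
apply: RintegralD => //.
  apply: (Qop_integrable (fun s => c ord0 * u ord0 s)).
  (* A scalar multiple is a linear combination with one term. *)
  have := @is_lipschitz_lincomb _ _ (@cube_dist R p) 1 (fun=> c ord0) (fun=> u ord0).
  by under eq_fun do rewrite big_ord1; exact.
apply: (Qop_integrable (fun s => \sum_(i < n) c (lift ord0 i) * u (lift ord0 i) s)).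
exact: is_lipschitz_lincomb.
Qed.

Lemma Qop_le_norm u k (M : R) : is_lipschitz (@cube_dist R p) u ->
  (forall s, `|u s| <= M) -> `|Qop Q u k| <= M.
Proof.
move=> uL uM.
apply: (le_trans (le_normr_Rintegral measurableT (Qop_integrable u k uL))).
(* [Q k] has mass one, so [M] is its own integral and monotonicity of the integral applies. *)
have cM : Rintegral (Q k) [set: borel (cube R p)] (fun=> M) = M.
  by rewrite Rintegral_cst// prob_kernel mulr1.
rewrite -[leRHS]cM; apply: le_Rintegral => //.
- apply: (Qop_integrable (fun s => `|u s|)).
  have [L hL] := uL; exists L => x y.
  exact: le_trans (ler_dist_dist _ _) (hL x y).
- apply: (Qop_integrable (fun=> M)).
  by exists 0 => x y; rewrite subrr normr0 mul0r.
Qed.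

(** The infimum is attained at the optimizer. In particular [J_AC] is finite, which keeps the
    extended-real differences of the theorem meaningful. *)
Lemma AC_optimizers_value (psi : SA R p q -> R) (rho : R) u :
  AC_optimizers Q psi (rho, u) -> J_AC Q psi = rho%:E.
Proof.
move=> [feas opt]; rewrite /J_AC (_ : ereal_inf _ = (- rho)%:E); last first.
  apply/eqP; rewrite eq_le; apply/andP; split.
    by apply: ereal_inf_lbound; exists (rho, u).
  by apply: le_ereal_inf_tmp => _ [z /opt ? <-].
by rewrite EFinN oppeK.
Qed.

(** Linearity of [Qop] identifies the two constraints. One direction gives the lower bound, the
    other certifies the witness for the upper bound. *)
Lemma ACn_feasible_AC (psi : SA R p q -> R) (n : nat)
    (u : 'I_n -> cube R p -> R) (N : 'rV[R]_n -> R) (thetaP rho : R)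
    (alpha : 'rV[R]_n) :
  (forall i, is_lipschitz (@cube_dist R p) (u i)) ->
  ACn_feasible Q psi u N thetaP (rho, alpha) <->
  AC_feasible Q psi (rho, fun s => \sum_(i < n) alpha ord0 i * u i s) /\
  N alpha <= thetaP.
Proof.
move=> uL.
have E s a : rho + \sum_(i < n) alpha ord0 i * (u i s - Qop Q (u i) (s, a)) =
    rho + (\sum_(i < n) alpha ord0 i * u i s) -
    Qop Q (fun s => \sum_(i < n) alpha ord0 i * u i s) (s, a).
  rewrite Qop_lincomb// -addrA -sumrB; congr (_ + _).
  by apply: eq_bigr => i _; rewrite mulrBr.
split=> [[feas Nle]|[[_ feas] Nle]]; split => //.
- split; first exact: is_lipschitz_lincomb.
  by move=> s a; have := feas s a; rewrite /= E.
- by move=> s a; have := feas s a; rewrite /= E.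
Qed.

(** Passing from [u] to [v] moves the function and its image under [Qop] by at most [M] each, so the
    left side of the constraint grows by at most [2 * M]. *)
Lemma AC_feasible_perturb (psi : SA R p q -> R) (rho M : R) u v :
  AC_feasible Q psi (rho, u) -> is_lipschitz (@cube_dist R p) v ->
  (forall s, `|u s - v s| <= M) -> AC_feasible Q psi (rho - 2 * M, v).
Proof.
move=> [/= uL feas] vL uvM; split=> //= s a.
have := feas s a; have := uvM s.
have := Qop_le_norm (fun s => u s - v s) (s, a) M (is_lipschitzB _ _ _ _ _ uL vL) uvM.
rewrite QopB// !ler_norml => /andP[? ?] /andP[? ?] ?; lra.
Qed.

End Qop_linear.

Theorem corollary3p9 (R : realType) (p q : nat)
    (Q : R.-pker (borel (SA R p q)) ~> (borel (cube R p)))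
    (LQ : R) (LQ_gt0 : 0 < LQ) (Q_lip : kernel_lipschitz Q LQ)
    (psi : SA R p q -> R) (psi_ge0 : forall k, 0 <= psi k)
    (psi_lip : is_lipschitz (@SA_dist R p q) psi)
    (n : nat) (u : 'I_n -> cube R p -> R)
    (u_lip : forall i, is_lipschitz (@cube_dist R p) (u i))
    (u_indep : lin_indep u)
    (u_norm1 : forall i, lip_norm (@cube_dist R p) (u i) = 1%:E)
    (N : 'rV[R]_n -> R) (N_norm : is_norm N)
    (thetaP : R) (thetaP_gt : (lip_norm (@SA_dist R p q) psi < thetaP%:E)%E)
    (rhostar : R) (ustar : cube R p -> R)
    (star_opt : AC_optimizers Q psi (rhostar, ustar))
    (Piu : cube R p -> R)
    (Piu_proj : argmin (fun v => lip_norm (@cube_dist R p) (v \- ustar))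
                       (Un u N thetaP) Piu) :
  (0 <= J_AC Q psi - J_ACn Q psi u N thetaP)%E /\
  (J_AC Q psi - J_ACn Q psi u N thetaP <=
     (1 + Num.max LQ 1)%:E * lip_norm (@cube_dist R p) (ustar \- Piu)%R)%E.
Proof.
rewrite (AC_optimizers_value _ _ _ _ star_opt); have [feas opt] := star_opt.
have [[alpha Nalpha Piu_def] _] := Piu_proj.
split.
  rewrite sube_ge0; last by rewrite orbT.
  rewrite /J_ACn leeNl; apply: le_ereal_inf_tmp => _ [[rho beta] + <-].
  by move=> /(ACn_feasible_AC _ _ _ _ _ _ _ _ u_lip)[/opt].
set l := lip_norm _ _.
have max1 : 1 <= Num.max LQ 1 by rewrite le_max lexx orbT.
have sup_l s : (`|ustar s - Piu s|%:E <= l)%E.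
  exact: le_trans (sup_norm_ub _ _ (ustar \- Piu) s) (le_sup_lip_norm _ _ _ _).
(* An infinite norm makes the right side [+oo], its factor being positive; [-oo] cannot dominate an
   absolute value at [point]. *)
case: l sup_l => [r sup_r|_|/(_ point)//]; last first.
  by rewrite gt0_muley ?leey// lte_fin; lra.
have r0 : 0 <= r by rewrite -lee_fin; apply: le_trans (sup_r point); rewrite lee_fin.
have Piu_lip : is_lipschitz (@cube_dist R p) Piu.
  by rewrite -Piu_def; exact: is_lipschitz_lincomb.
have : ACn_feasible Q psi u N thetaP (rhostar - 2 * r, alpha).
  apply/ACn_feasible_AC => //; split; last exact: Nalpha.
  by rewrite Piu_def; apply: AC_feasible_perturb feas Piu_lip _.
(* The signs cancel: the gap is [rhostar] plus the infimum of the semi-infinite program, so a single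
   feasible point bounds it from above. *)
move=> feasn; rewrite /J_ACn oppeK.
have inf_le : (ereal_inf [set (- z.1)%:E | z in ACn_feasible Q psi u N thetaP] <=
    (- (rhostar - 2 * r))%:E)%E.
  by apply: ereal_inf_lbound; exists (rhostar - 2 * r, alpha).
apply: le_trans (leeD2l _ inf_le) _; rewrite -EFinD -EFinM lee_fin.
(* After [rhostar] cancels, [2 * r <= (1 + Num.max LQ 1) * r] remains, which follows from [r0] and
   [max1]. *)
nra.
Qed.
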